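(* Let $X$ and $Y$ be nontrivial separable real Banach spaces with the almost Daugavet property and $N$ an absolute normalized norm on $\mathbb{R}^2$. Then $X\oplus_N Y$ has the almost Daugavet property if and only if $(\mathbb{R}^2,N)$ is positively octahedral.
   Context: A Banach space $X$ has the almost Daugavet property if there is a 1-norming subspace $W$ of $X^\ast$ (that is, $\|x\|=\sup\{|w^\ast(x)|: w^\ast\in W,\ \|w^\ast\|\le 1\}$ for all $x\in X$) such that $\|\mathrm{Id}+T\|=1+\|T\|$ holds for every rank-one operator $T\colon X\to X$ of the form $T=w^\ast\otimes x$ (i.e. $T(z)=w^\ast(z)x$), where $x\in X$ and $w^\ast\in W$. A norm $N$ on $\mathbb{R}^2$ is absolute if $N(a,b)=N(|a|,|b|)$ for all $(a,b)\in\mathbb{R}^2$, and normalized if $N(1,0)=N(0,1)=1$. $X\oplus_N Y$ is the product space $X\times Y$ with the norm $\|(x,y)\|_N=N(\|x\|,\|y\|)$. An element $(a,b)\in\mathbb{R}^2$ is positive if $a\geq0$ and $b\geq0$. For an absolute normalized norm $N$, $(\mathbb{R}^2,N)$ is positively octahedral if whenever $n\in\mathbb{N}$ and $(a_1,b_1),\dots,(a_n,b_n)$ are positive elements of the unit sphere $S_{(\mathbb{R}^2,N)}$, there is a positive $(c,d)\in S_{(\mathbb{R}^2,N)}$ such that $N\big((a_i,b_i)+(c,d)\big)=2$ for all $i\in\{1,\dots,n\}$. A Banach space is nontrivial if it is not $\{0\}$. *)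

(* Defs.v *)
From HB Require Import structures.
From mathcomp Require Import all_boot all_order all_algebra.
From mathcomp Require Import all_classical all_reals topology normedtype.
From mathcomp Require Import ring lra.
Set Implicit Arguments.
Unset Strict Implicit.
Unset Printing Implicit Defensive.
Import Order.TTheory GRing.Theory Num.Theory.
Import numFieldNormedType.Exports.
Local Open Scope classical_set_scope.
Local Open Scope ring_scope.

Definition nontrivial (R : realType) (X : normedModType R) : Prop :=
  exists x : X, x != 0.

Definition separable (T : topologicalType) : Prop :=
  exists2 D : set T, countable D & dense D.

(* The operator norm; [sup] is only meaningful when the set is bounded above,
   i.e. when the linear map [f] is continuous, and it is only used then. *)
Definition opnorm (R : realType) (V W : normedModType R) (f : V -> W) : R :=
  sup [set `|f x| | x in [set x | `|x| <= 1]].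

Definition dual (R : realType) (X : normedModType R) : set (X -> R) :=
  [set f | linear f /\ continuous f].

(* Linear subspaces of the dual, not required to be closed. *)
Definition dual_subspace (R : realType) (X : normedModType R)
    (W : set (X -> R)) : Prop :=
  [/\ W `<=` @dual R X, W (fun=> 0) &
      forall (a : R) f g, W f -> W g -> W (fun x => a * f x + g x)].

Definition one_norming (R : realType) (X : normedModType R)
    (W : set (X -> R)) : Prop :=
  forall x : X, `|x| = sup [set `|w x| | w in [set w | W w /\ opnorm w <= 1]].

Definition rank_one (R : realType) (X : normedModType R) (w : X -> R) (x : X) :
  X -> X := fun z => w z *: x.

Definition almost_daugavet (R : realType) (X : completeNormedModType R) : Prop :=
  exists W : set (X -> R),
    [/\ dual_subspace W, one_norming W &
        forall (x : X) (w : X -> R), W w ->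
          opnorm (fun z => z + rank_one w x z) = 1 + opnorm (rank_one w x)].

Record abs_norm (R : realType) := AbsNorm {
  abs_norm_fun :> R * R -> R;
  abs_normD : forall p q, abs_norm_fun (p + q) <= abs_norm_fun p + abs_norm_fun q;
  abs_normZ : forall (t a b : R),
    abs_norm_fun (t * a, t * b) = `|t| * abs_norm_fun (a, b);
  abs_norm_eq0 : forall p, abs_norm_fun p = 0 -> p = 0;
  abs_norm_abs : forall a b : R, abs_norm_fun (a, b) = abs_norm_fun (`|a| : R, `|b| : R);
  abs_norm10 : abs_norm_fun (1, 0) = 1;
  abs_norm01 : abs_norm_fun (0, 1) = 1 }.

Definition pos_pair (R : realType) (p : R * R) : Prop := 0 <= p.1 /\ 0 <= p.2.

Definition positively_octahedral (R : realType) (N : abs_norm R) : Prop :=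
  forall (n : nat) (p : 'I_n -> R * R),
    (forall i, pos_pair (p i) /\ N (p i) = 1) ->
    exists q : R * R, [/\ pos_pair q, N q = 1 & forall i, N (p i + q) = 2].

Section AbsNormTheory.
Variables (R : realType) (N : abs_norm R).
Implicit Types a b c d t : R.

Lemma abs_norm0 : N (0, 0) = 0.
Proof. by have := abs_normZ N 0 0 0; rewrite mul0r normr0 mul0r. Qed.

Lemma abs_normN p : N (- p) = N p.
Proof.
case: p => a b; rewrite -[- (a, b)]/(- a, - b) -(mulN1r a) -(mulN1r b).
by rewrite abs_normZ normrN1 mul1r.
Qed.

Lemma abs_norm_ge0 p : 0 <= N p.
Proof.
have := abs_normD N p (- p).
by rewrite abs_normN subrr (_ : N 0 = 0) ?abs_norm0//; lra.
Qed.

Lemma abs_norm_oppl a b : N (- a, b) = N (a, b).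
Proof. by rewrite [LHS]abs_norm_abs normrN -abs_norm_abs. Qed.

Lemma abs_norm_convex t a b c d : 0 <= t <= 1 ->
  N (t * a + (1 - t) * c, t * b + (1 - t) * d) <=
  t * N (a, b) + (1 - t) * N (c, d).
Proof.
move=> /andP[t0 t1]; apply: le_trans (abs_normD N (_, _) (_, _)) _.
by rewrite !abs_normZ !ger0_norm ?subr_ge0.
Qed.

Lemma abs_norm_monol a c b : 0 <= a <= c -> N (a, b) <= N (c, b).
Proof.
move=> /andP[a0 ac]; have [c0|c0] := eqVneq c 0.
  by have -> : a = c by lra.
have cgt0 : 0 < c by rewrite lt_def c0 (le_trans a0 ac).
pose t := (1 + a / c) / 2.
have ac1 : a / c <= 1 by rewrite ler_pdivrMr// mul1r.
have ac0 : 0 <= a / c by rewrite divr_ge0 // ltW.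
have t01 : 0 <= t <= 1 by rewrite /t; lra.
have := abs_norm_convex c b (- c) b t01.
rewrite abs_norm_oppl -mulrDl (_ : t + (1 - t) = 1) ?mul1r; last by ring.
rewrite (_ : t * c + _ = a); last by rewrite /t; field.
by rewrite -mulrDl (_ : t + (1 - t) = 1) ?mul1r; last by ring.
Qed.

Lemma abs_norm_monor a b d : 0 <= b <= d -> N (a, b) <= N (a, d).
Proof.
have oppr x y : N (x, - y) = N (x, y).
  by rewrite [LHS]abs_norm_abs normrN -abs_norm_abs.
move=> /andP[b0 bd]; have [d0|d0] := eqVneq d 0.
  by have -> : b = d by lra.
have dgt0 : 0 < d by rewrite lt_def d0 (le_trans b0 bd).
pose t := (1 + b / d) / 2.
have bd1 : b / d <= 1 by rewrite ler_pdivrMr// mul1r.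
have bd0 : 0 <= b / d by rewrite divr_ge0 // ltW.
have t01 : 0 <= t <= 1 by rewrite /t; lra.
have := abs_norm_convex a d a (- d) t01.
rewrite oppr -mulrDl (_ : t + (1 - t) = 1) ?mul1r; last by ring.
rewrite (_ : t * d + _ = b); last by rewrite /t; field.
by rewrite -mulrDl (_ : t + (1 - t) = 1) ?mul1r; last by ring.
Qed.

Lemma abs_norm_mono a b c d :
  0 <= a <= c -> 0 <= b <= d -> N (a, b) <= N (c, d).
Proof.
by move=> ac bd; exact: le_trans (abs_norm_monol b ac) (abs_norm_monor c bd).
Qed.

Lemma abs_normr0 a : N (a, 0) = `|a|.
Proof. by have := abs_normZ N a 1 0; rewrite mulr1 mulr0 abs_norm10 mulr1. Qed.

Lemma abs_norm0r b : N (0, b) = `|b|.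
Proof. by have := abs_normZ N b 0 1; rewrite mulr1 mulr0 abs_norm01 mulr1. Qed.

Lemma abs_norm_gel a b : `|a| <= N (a, b).
Proof.
rewrite abs_norm_abs; have := abs_norm_monor (`|a|) (b := 0) (d := `|b|).
by rewrite abs_normr0 normr_id; apply; rewrite lexx normr_ge0.
Qed.

Lemma abs_norm_ger a b : `|b| <= N (a, b).
Proof.
rewrite abs_norm_abs; have := abs_norm_monol (a := 0) (c := `|a|) (`|b|).
by rewrite abs_norm0r normr_id; apply; rewrite lexx normr_ge0.
Qed.

Lemma abs_norm_le_sum a b : N (a, b) <= `|a| + `|b|.
Proof.
have -> : (a, b) = (a, 0) + (0, b) :> R * R.
  by apply/pair_equal_spec; rewrite addr0 add0r.
by rewrite -abs_normr0 -abs_norm0r abs_normD.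
Qed.

End AbsNormTheory.

Definition nsum (R : realType) (N : abs_norm R) (X Y : normedModType R) : Type :=
  (X * Y)%type.

Section NSum.
Variables (R : realType) (N : abs_norm R) (X Y : normedModType R).

HB.instance Definition _ := GRing.Lmodule.copy (nsum N X Y) (X * Y)%type.

Let nrm (z : nsum N X Y) : R := N (`|z.1|, `|z.2|).

Let nrmD z1 z2 : nrm (z1 + z2) <= nrm z1 + nrm z2.
Proof.
rewrite /nrm (le_trans _ (abs_normD _ _ _))//.
by apply: abs_norm_mono; rewrite normr_ge0 ler_normD.
Qed.

Let nrmZ (l : R) z : nrm (l *: z) = `|l| * nrm z.
Proof. by rewrite /nrm !normrZ abs_normZ normr_id. Qed.

Let nrm_eq0 z : nrm z = 0 -> z = 0.
Proof.
case: z => x y /abs_norm_eq0 [/eqP + /eqP].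
by rewrite !normr_eq0 => /eqP -> /eqP ->.
Qed.

HB.instance Definition _ :=
  Lmodule_isNormed.Build R (nsum N X Y) nrmD nrmZ nrm_eq0.

Lemma nsum_normE (z : nsum N X Y) : `|z| = N (`|z.1|, `|z.2|).
Proof. by []. Qed.

End NSum.

Section NSumComplete.
Variables (R : realType) (N : abs_norm R) (X Y : completeNormedModType R).

Lemma nsum_complete (F : set_system (nsum N X Y)) :
  ProperFilter F -> cauchy F -> cvg F.
Proof.
move=> FF /cauchy_ballP Fc.
have cX : cauchy ((fun z : nsum N X Y => z.1 : X) @ F).
  apply/cauchy_ballP => e e0; have := Fc e e0.
  case=> -[A B] /= [FA FB] AB.
  exists ((fun z : nsum N X Y => z.1 : X) @` A, (fun z : nsum N X Y => z.1 : X) @` B).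
    by split; [apply: filterS FA | apply: filterS FB] => z ?; exists z.
  move=> [_ _] /= [[z1 Az <-] [z2 Bz <-]].
  have := AB (z1, z2) (conj Az Bz).
  rewrite -!ball_normE /ball_ /= nsum_normE; apply: le_lt_trans.
  by rewrite -[X in X <= _]normr_id abs_norm_gel.
have cY : cauchy ((fun z : nsum N X Y => z.2 : Y) @ F).
  apply/cauchy_ballP => e e0; have := Fc e e0.
  case=> -[A B] /= [FA FB] AB.
  exists ((fun z : nsum N X Y => z.2 : Y) @` A, (fun z : nsum N X Y => z.2 : Y) @` B).
    by split; [apply: filterS FA | apply: filterS FB] => z ?; exists z.
  move=> [_ _] /= [[z1 Az <-] [z2 Bz <-]].
  have := AB (z1, z2) (conj Az Bz).
  rewrite -!ball_normE /ball_ /= nsum_normE; apply: le_lt_trans.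
  by rewrite -[X in X <= _]normr_id abs_norm_ger.
have /cvg_ex[x xF] : cvg ((fun z : nsum N X Y => z.1 : X) @ F) by exact: cauchy_cvg.
have /cvg_ex[y yF] : cvg ((fun z : nsum N X Y => z.2 : Y) @ F) by exact: cauchy_cvg.
apply/cvg_ex; exists ((x, y) : nsum N X Y).
apply/(@cvgrPdist_lt _ (nsum N X Y) _ F _ id) => e e0.
have e20 : 0 < e / 2 by rewrite divr_gt0.
have {}xF : \forall z \near F, `|x - z.1| < e / 2.
  exact: (@cvgr_dist_lt _ X _ F _ _ _ xF _ e20).
have {}yF : \forall z \near F, `|y - z.2| < e / 2.
  exact: (@cvgr_dist_lt _ Y _ F _ _ _ yF _ e20).
apply: filterS2 xF yF => z xz yz.
rewrite nsum_normE (le_lt_trans (abs_norm_le_sum _ _ _))// !normr_id.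
by rewrite [e]splitr ltrD.
Qed.

HB.instance Definition _ := Uniform_isComplete.Build (nsum N X Y) nsum_complete.

End NSumComplete.

(* Main.v *)
Require Import Defs.
From HB Require Import structures.
From mathcomp Require Import all_boot all_order all_algebra.
From mathcomp Require Import all_classical all_reals interval_inference.
From mathcomp Require Import topology normedtype.
From mathcomp Require Import ring lra zify.
Set Implicit Arguments.
Unset Strict Implicit.
Unset Printing Implicit Defensive.
Import Order.TTheory GRing.Theory Num.Theory.
Import numFieldNormedType.Exports.
Local Open Scope classical_set_scope.
Local Open Scope ring_scope.

(** The bridge between the two sides is octahedrality: for finitely many vectors
    [u] there is a single [z] in the unit ball with [|u + z|] almost [|u| + 1].
    For a nontrivial separable space it is equivalent to the almost Daugavet
    property, and it passes to and from [nsum N X Y] in the way the norm [N]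
    suggests.

    Almost Daugavet implies octahedral ([daugavet_octahedral]).  One builds
    functionals [w_1, ..., w_n] of norm at most [1], each almost norming its
    vector, together with a point of the ball at which all of them are almost
    [1]; adding such a point to any of these vectors makes it longer by almost
    [1].  The sum [v] of the functionals is in the subspace [W], so the Daugavet
    equation for [z |-> v(z) x], with [x] the direction of the next vector, gives
    a point [z] of the ball for which [z + v(z) x] is almost as long as possible;
    a functional that norms this vector is almost [1] at [z] and at [x], and can
    be added to the list.

    Octahedral and separable implies almost Daugavet
    ([octahedral_almost_daugavet]).  Octahedrality is used recursively to choose
    [e_0, e_1, ...] in the ball such that the norm is almost additive along the
    vectors [d_k + s_k(k) e_k + ... + s_k(j) e_j], where [d] is dense and [s_k]
    is the [k]-th Rademacher sequence of signs.  A functional [w_k] that almost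
    norms all these vectors, obtained as a limit along an ultrafilter, almost
    norms [d_k] and satisfies [s_k(j) w_k(e_j) -> 1] ([rademacher_system]).  The
    span of the [w_k] is one-norming.  As every pattern of finitely many signs
    occurs at arbitrarily late times, [sum c_k w_k] almost takes the value
    [sum |c_k|], an upper bound of its norm, at some [e_j] for which
    [|e_j + y|] is almost [1 + |y|], with [y] any prescribed vector; this is the
    Daugavet equation.

    Sums.  Norms of vectors [(a_i x, b_i y)] with [x], [y] fixed unit vectors
    depend on the pairs [(a_i, b_i)] only, so octahedrality of the sum gives,
    up to arbitrarily small errors, the pair [(c, d)] of positive octahedrality,
    and a limit point removes the errors ([octahedral_sum_pos]).  Conversely
    [(c x, d y)] with [x] and [y] given by octahedrality of the two summands
    witnesses octahedrality of the sum ([octahedral_sum]).  The contractive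
    functionals almost norming the vectors of the sum, from which the [w_k]
    are built, combine functionals of the summands by means of a supporting
    line of [N] ([norming_sum]). *)

(** * Functionals and operator norms *)

Section Functionals.
Context {R : realType} {X : normedModType R}.
Implicit Types (f : X -> R) (x y : X).

Definition contractive f : Prop := linear f /\ forall x, `|f x| <= `|x|.

Lemma linear_funD f x y : linear f -> f (x + y) = f x + f y.
Proof. by move=> lf; have := lf 1 x y; rewrite !scale1r. Qed.

Lemma linear_funZ f a x : linear f -> f (a *: x) = a * f x.
Proof.
move=> lf; have f0 : f 0 = 0.
  have /eqP := lf 1 0 0; rewrite !scale1r !addr0 eq_sym -subr_eq0 addrK.
  by move/eqP.
by have := lf a x 0; rewrite !addr0 f0 addr0.
Qed.

Lemma linear_funN f x : linear f -> f (- x) = - f x.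
Proof. by move=> lf; rewrite -scaleN1r linear_funZ// mulN1r. Qed.

Lemma dual_bounded f : dual f -> exists M, forall x, `|f x| <= M * `|x|.
Proof.
case=> lf cf.
pose g : {linear X -> R} := HB.pack f (GRing.isLinear.Build R X R _ f lf).
have /linear_boundedP/pinfty_ex_gt0[M _ gM] : bounded_near g (nbhs 0).
  by apply/linear_bounded_continuous; exact: cf.
by exists M.
Qed.

Lemma linear_bounded_dual f M :
  linear f -> (forall x, `|f x| <= M * `|x|) -> dual f.
Proof.
move=> lf fM; split=> //.
pose g : {linear X -> R} := HB.pack f (GRing.isLinear.Build R X R _ f lf).
suff: continuous g by [].
apply/linear_bounded_continuous/linear_boundedP.
near=> r => x; apply: le_trans (fM x) _; rewrite ler_wpM2r//.
by near: r; apply: nbhs_pinfty_ge; exact: num_real.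
Unshelve. all: by end_near. Qed.

Section Opnorm.
Context {V : normedModType R} (g : X -> V).

Lemma opnorm_le C : (forall x, `|x| <= 1 -> `|g x| <= C) -> opnorm g <= C.
Proof.
move=> gC; apply: ge_sup.
  by exists `|g 0|; exists 0 => //=; rewrite normr0 ler01.
by move=> _ [x /= x1 <-]; exact: gC.
Qed.

Lemma le_opnorm C x :
  (forall x, `|x| <= 1 -> `|g x| <= C) -> `|x| <= 1 -> `|g x| <= opnorm g.
Proof.
move=> gC x1; apply: ub_le_sup; last by exists x.
by exists C => _ [z /= z1 <-]; exact: gC.
Qed.

(** A positive operator norm is finite, since the supremum of an unbounded set
    is [0] by convention. *)
Lemma opnorm_almost_attained c :
  0 <= c -> c < opnorm g -> exists2 x, `|x| <= 1 & c < `|g x|.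
Proof.
move=> c0 cg; set A := [set `|g x| | x in [set x | `|x| <= 1]].
have [supA|/sup_out A0] := pselect (has_sup A); last first.
  by move: cg; rewrite /opnorm -/A A0 ltNge c0.
have e0 : 0 < sup A - c by rewrite subr_gt0.
by have [_ [x x1 <-]] := sup_adherent e0 supA; rewrite subKr; exists x.
Qed.

End Opnorm.

Lemma opnorm_le1_contractive f : dual f -> opnorm f <= 1 -> contractive f.
Proof.
move=> df f1; split=> [|x]; first by case: df.
have [M fM] := dual_bounded df; have [lf _] := df.
have [->|x0] := eqVneq x 0.
  by rewrite -(scale0r (0 : X)) linear_funZ// mul0r !normr0.
have nx : 0 < `|x| by rewrite normr_gt0.
have u1 : `| `|x|^-1 *: x| <= 1.
  by rewrite normrZ normfV normr_id mulVf// gt_eqF.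
have : `|f (`|x|^-1 *: x)| <= 1.
  apply: le_trans f1; apply: (le_opnorm (C := `|M|)) => // z z1.
  apply: le_trans (fM z) _; apply: le_trans (ler_norm _) _.
  by rewrite normrM normr_id -[leRHS]mulr1 ler_wpM2l.
by rewrite linear_funZ// normrM normfV normr_id ler_pdivrMl// mulr1.
Qed.

Lemma contractive_opnorm f : contractive f -> opnorm f <= 1.
Proof. by case=> _ fx; apply: opnorm_le => x; apply: le_trans. Qed.

Lemma contractive_le f x : contractive f -> f x <= `|x|.
Proof. by case=> _ fx; apply: le_trans (ler_norm _) (fx x). Qed.

Lemma contractiveN f : contractive f -> contractive (fun x => - f x).
Proof.
case=> lf fx; split=> [a x y|x]; last by rewrite normrN.
by rewrite lf opprD scalerN.
Qed.

(** [W] is closed under [-], so the absolute values can be dropped from the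
    definition of a one-norming subspace. *)
Lemma one_norming_approx (W : set (X -> R)) x e :
  dual_subspace W -> one_norming W -> 0 < e ->
  exists w, [/\ W w, contractive w & `|x| - e < w x].
Proof.
move=> [Wd W0 Wlin] nW e0.
have WN w : W w -> W (fun x => - w x).
  move=> Ww; have := Wlin (-1) w _ Ww W0; congr W.
  by apply/funext => z; rewrite addr0 mulN1r.
suff [w [Ww cw]] : exists w, [/\ W w, contractive w & `|x| - e < `|w x|].
  have [wx|wx] := leP 0 (w x) => we.
    by exists w; rewrite ger0_norm in we.
  exists (fun x => - w x); split; [exact: WN|exact: contractiveN|].
  by rewrite ltr0_norm in we.
set A := [set `|w x| | w in [set w | W w /\ opnorm w <= 1]].
have supA : has_sup A.
  split.
    exists `|0 : R|; exists (fun=> 0) => //; split=> //.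
    by apply: opnorm_le => z _; rewrite normr0 ler01.
  exists `|x| => _ [w [Ww w1] <-].
  by have [] := opnorm_le1_contractive (Wd _ Ww) w1.
have [_ [w [Ww w1] <-]] := sup_adherent e0 supA.
rewrite -nW => we; exists w; split=> //.
exact: opnorm_le1_contractive (Wd _ Ww) w1.
Qed.

End Functionals.

(** * The Daugavet equation makes a space octahedral *)

Definition octahedral {R : realType} (X : normedModType R) : Prop :=
  forall (s : seq X) (e : R), 0 < e ->
  exists2 z : X, `|z| <= 1 & forall u, u \in s -> `|u| + 1 - e <= `|u + z|.

Section DaugavetOctahedral.
Context {R : realType} {X : normedModType R}.

(** For [u = 0] any unit vector serves as [x]; thus zero vectors need no separate
    treatment below. *)
Lemma polar_decomposition (u : X) :
  nontrivial X -> exists2 x : X, `|x| = 1 & u = `|u| *: x.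
Proof.
have unit (v : X) : v != 0 -> `| `|v|^-1 *: v| = 1.
  by move=> v0; rewrite normrZ normfV normr_id mulVf// normr_eq0.
case=> x0 x0n0; have [->|un0] := eqVneq u 0.
  by exists (`|x0|^-1 *: x0); rewrite ?unit// normr0 scale0r.
exists (`|u|^-1 *: u); rewrite ?unit//.
by rewrite scalerA divff ?scale1r// normr_eq0.
Qed.

Lemma common_norming_norm_ge (w : X -> R) (u x z : X) d :
  contractive w -> u = `|u| *: x -> 1 - d <= w x -> 1 - d <= w z ->
  (1 - d) * (`|u| + 1) <= `|u + z|.
Proof.
move=> cw ux wx wz; apply: le_trans (contractive_le _ cw); have [lw _] := cw.
rewrite (linear_funD _ _ lw) {2}ux (linear_funZ _ _ lw) mulrDr mulr1 lerD// mulrC.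
by rewrite ler_wpM2l.
Qed.

Variable W : set (X -> R).
Hypotheses (Xnt : nontrivial X) (subW : dual_subspace W).
Hypotheses (normW : one_norming W) (daugavetW : forall (x : X) (w : X -> R),
  W w -> opnorm (fun z => z + rank_one w x z) = 1 + opnorm (rank_one w x)).

(** As [z + v z *: x] is odd in [z], the sign of [v z] is free. *)
Lemma daugavet_unit (v : X -> R) (x y : X) (n e : R) :
  W v -> (forall z, `|v z| <= n * `|z|) -> `|x| = 1 ->
  `|y| <= 1 -> 0 <= n - e -> n - e < v y ->
  exists z, [/\ `|z| <= 1, 0 <= v z & 1 + (n - e) < `|z + v z *: x|].
Proof.
move=> Wv vn x1 y1 ne0 nevy.
have lv : linear v by case: subW => + _ _ => /(_ _ Wv) [].
suff [z z1 zl] : exists2 z, `|z| <= 1 & 1 + (n - e) < `|z + v z *: x|.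
  have [vz|vz] := leP 0 (v z); first by exists z.
  exists (- z); rewrite (linear_funN z lv) oppr_ge0 normrN.
  by rewrite scaleNr -opprD normrN; split=> //; exact: ltW.
apply: (@opnorm_almost_attained _ _ _ (fun z => z + rank_one v x z)).
  lra.
rewrite daugavetW// ltrD2l; apply: lt_le_trans nevy _.
apply: le_trans (ler_norm _) _.
have -> : `|v y| = `|rank_one v x y| by rewrite /rank_one normrZ x1 mulr1.
apply: (le_opnorm (C := `|n|)) => // z z1.
rewrite /rank_one normrZ x1 mulr1 (le_trans (vn z))// (le_trans (ler_norm _))//.
by rewrite normrM normr_id -[leRHS]mulr1 ler_wpM2l.
Qed.

(** The functional [v] is the sum of one functional for each entry of [s].  Each
    of them is at most [1] on the ball, so at a point where the sum is at least
    [size s - d] all of them are at least [1 - d].  The conclusion is stated for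
    the whole slice of [v], and for every [d >= e], so that it survives the
    addition of another functional. *)
Lemma daugavet_slice (s : seq X) : s != [::] -> forall e : R, 0 < e ->
  exists (v : X -> R) (y : X),
  [/\ W v, `|y| <= 1, forall z, `|v z| <= (size s)%:R * `|z|,
      (size s)%:R - e < v y &
      forall z d, `|z| <= 1 -> e <= d -> (size s)%:R - d <= v z ->
      forall u, u \in s -> (1 - d) * (`|u| + 1) <= `|u + z|].
Proof.
elim: s => // u s IH _ e e0.
have [x x1 ux] := polar_decomposition u Xnt.
have [s0|sn0] := eqVneq s [::].
  have [w [Ww cw wx]] := one_norming_approx x subW normW e0.
  rewrite x1 in wx; exists w, x; rewrite s0 x1; split=> //.
    by move=> z; rewrite mul1r; case: cw.
  move=> z d _ ed wz u'; rewrite inE => /eqP ->.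
  by apply: (common_norming_norm_ge cw ux) => //; lra.
pose n : R := (size s)%:R.
have n1 : 1 <= n by rewrite ler1n lt0n size_eq0.
pose e' : R := Num.min (e / 2) (1 / 2).
have [e'0 e'e e'1] : [/\ 0 < e', e' <= e / 2 & e' <= 1 / 2].
  by rewrite /e' lt_min !ge_min !lexx orbT; split=> //; lra.
have [v [y [Wv y1 vn vy vs]]] := IH sn0 e' e'0.
have [|z [z1 vz0 zl]] := daugavet_unit Wv vn x1 y1 _ vy; first by rewrite -/n; lra.
rewrite -/n in vn vy vs zl.
have gap : 0 < `|z + v z *: x| - (1 + (n - e')) by rewrite subr_gt0.
have [w [Ww cw wz]] := one_norming_approx (z + v z *: x) subW normW gap.
have [lw wle] := cw.
move: wz; rewrite subKr (linear_funD _ _ lw) (linear_funZ _ _ lw) => wz.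
have wz1 : w z <= 1 by apply: le_trans (contractive_le _ cw) z1.
have wx1 : w x <= 1 by rewrite -x1; exact: contractive_le.
have vzn : v z <= n.
  apply: le_trans (ler_norm _) (le_trans (vn z) _).
  by rewrite -[leRHS]mulr1 ler_wpM2l//; lra.
(* [w z + v z * w x] exceeds [1 + n - e'], whereas [w z], [v z] and [w x] are at
   most [1], [n] and [1]: each of them is almost maximal. *)
have wx0 : 0 < w x by rewrite ltNge; apply/negP => wx0; nra.
have wzlow : 1 - e' < w z by nra.
have wxlow : 1 - e' < w x by nra.
have vzlow : n - e' < v z by nra.
have [Wd W0 Wlin] := subW.
exists (fun t => v t + w t), z; rewrite /= -add1n natrD -/n.
split=> //.
- by have := Wlin 1 v w Wv Ww; congr W; apply/funext => t; rewrite mul1r.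
- move=> t; apply: le_trans (ler_normD _ _) _.
  by rewrite mulrDl mul1r addrC lerD.
- lra.
move=> t d t1 ed vwt u'; rewrite inE => /predU1P[->|].
  have vtn : v t <= n.
    apply: le_trans (ler_norm _) (le_trans (vn t) _).
    by rewrite -[leRHS]mulr1 ler_wpM2l//; lra.
  by apply: (common_norming_norm_ge cw ux) => //; lra.
apply: vs => //; first by lra.
have := le_trans (contractive_le t cw) t1; lra.
Qed.

Lemma daugavet_octahedral : octahedral X.
Proof.
move=> [|u0 s] e e0; first by exists 0; rewrite ?normr0.
set s' := u0 :: s; pose M := \sum_(u <- s') `|u|.
have uM u : u \in s' -> `|u| <= M.
  move=> us; rewrite /M (big_rem u)//= lerDl; exact: sumr_ge0.
have M0 : 0 <= M by apply: sumr_ge0.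
have d0 : 0 < e / (M + 1) by rewrite divr_gt0// ltr_wpDl.
have [//|v [y [_ y1 _ vy vs]]] := @daugavet_slice s' _ _ d0.
exists y => // u us; apply: le_trans (vs y _ y1 (lexx _) (ltW vy) u us).
rewrite mulrBl mul1r lerD2l lerNr opprK mulrAC ler_pdivrMr; last lra.
by rewrite ler_pM2l// lerD2r uM.
Qed.

End DaugavetOctahedral.

Lemma almost_daugavet_octahedral {R : realType} (X : completeNormedModType R) :
  nontrivial X -> almost_daugavet X -> octahedral X.
Proof. by move=> ? [W [? ? ?]]; exact: (@daugavet_octahedral _ _ W). Qed.

(** * Octahedrality of absolute sums *)

(** A single filter makes all bounded sequences converge, so that limits along it
    commute with the algebraic operations. *)
Lemma ultralimits (R : realType) : exists U : set_system nat,
  [/\ ProperFilter U, \oo `<=` U &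
   forall (a : nat -> R) (M : R), (forall n, `|a n| <= M) ->
   exists l : R, a @ U --> l].
Proof.
have [U [UU ooU]] := ultraFilterLemma (@eventually_filter).
exists U; split=> [|//|a M aM]; first exact: ultra_proper.
have := @segment_compact R (- M) M; rewrite compact_ultra => /(_ (a @ U)).
case=> [| |l [_ al]]; last by exists l.
  split=> [|G GG aUG]; first exact: fmap_proper_filter.
  apply/seteqP; split=> // A GA.
  have [//|UnA] := in_ultra_setVsetC (a @^-1` A) UU.
  have /filter_ex[r [Ar nAr]] : G (A `&` ~` A) by apply: filterI => //; exact: aUG.
  by [].
rewrite /fmap/=; apply: (@filterS _ U _ setT _ _ filterT) => n _ /=.
by rewrite in_itv/= -ler_norml.
Qed.

Section AbsNorm.
Context {R : realType} (N : abs_norm R).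

Lemma abs_norm_lipschitzD (p q q' : R * R) :
  N (p + q') <= N (p + q) + (`|q'.1 - q.1| + `|q'.2 - q.2|).
Proof.
have -> : p + q' = (p + q) + (q' - q) by rewrite addrACA subrr addr0.
apply: le_trans (abs_normD _ _ _) _.
by rewrite lerD2l; exact: abs_norm_le_sum.
Qed.

Lemma abs_norm_mono_norm (a b c d : R) :
  `|a| <= c -> `|b| <= d -> N (a, b) <= N (c, d).
Proof.
by move=> ac bd; rewrite abs_norm_abs abs_norm_mono ?normr_ge0 ?ac ?bd.
Qed.

End AbsNorm.

Section OctahedralSum.
Context {R : realType} {N : abs_norm R} {X Y : normedModType R}.

(** The vectors tested are [(a_i x, b_i y)] with [|x| = |y| = 1], and the pair
    sought is a limit point of the pairs [(|z.1|, |z.2|)], where [z] is in the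
    unit ball and [|u + z|] is almost [2] for each tested vector [u]. *)
Lemma octahedral_sum_pos : nontrivial X -> nontrivial Y ->
  octahedral (nsum N X Y) -> positively_octahedral N.
Proof.
move=> Xnt Ynt octZ n p pP.
have [n0|n0] := posnP n.
  exists (1, 0); split=> [||i]; first by split; rewrite /= ?ler01.
    exact: abs_norm10.
  by have := ltn_ord i; rewrite [X in (_ < X)%N]n0.
have [x x1 _] := polar_decomposition 0 Xnt.
have [y y1 _] := polar_decomposition 0 Ynt.
pose u i : nsum N X Y := ((p i).1 *: x, (p i).2 *: y).
have un i : `|u i| = 1.
  have [[a0 b0] pi1] := pP i; rewrite nsum_normE !normrZ x1 y1 !mulr1 -pi1.
  by rewrite !ger0_norm//; case: (p i).
have [h h0 hlim] : exists2 h : nat -> R, forall m, 0 < h m &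
    forall e : R, 0 < e -> \forall m \near \oo, h m < e.
  exists (fun m => m.+1%:R^-1) => [m|_ /posnumP[e]]; first by rewrite invr_gt0.
  exact: near_infty_natSinv_lt.
have /choice[z zP] m : exists z : nsum N X Y,
    `|z| <= 1 /\ forall i, 2 - h m <= `|u i + z|.
  have [z z1 zu] := octZ [seq u i | i <- enum 'I_n] _ (h0 m).
  exists z; split=> // i; apply: le_trans _ (zu _ (map_f _ (mem_enum _ i))).
  by rewrite un; lra.
have [U [UF ooU Ulim]] := ultralimits R.
have Nz m : N (`|(z m).1|, `|(z m).2|) <= 1 by have [] := zP m.
have [|c zc] := Ulim (fun m => `|(z m).1|) 1.
  move=> m; rewrite normr_id (le_trans _ (Nz m))// -[leLHS]normr_id.
  exact: abs_norm_gel.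
have [|d zd] := Ulim (fun m => `|(z m).2|) 1.
  move=> m; rewrite normr_id (le_trans _ (Nz m))// -[leLHS]normr_id.
  exact: abs_norm_ger.
(* One index serves all errors at once, as a filter is closed under
   intersection. *)
have near_cd e : 0 < e -> exists m,
   [/\ `|c - `|(z m).1| | < e, `|d - `|(z m).2| | < e & h m < e].
  move=> e0; move/cvgrPdist_lt : zc => /(_ e e0) ze.
  move/cvgrPdist_lt : zd => /(_ e e0) ze'.
  have zi : \forall m \near U, h m < e.
    by apply: ooU; exact: hlim.
  have [m [[? ?] ?]] := filter_ex (filterI (filterI ze ze') zi).
  by exists m.
have cge0 : 0 <= c.
  rewrite leNgt; apply/negP => c0.
  have [|m [+ _ _]] := near_cd (- c); first by rewrite oppr_gt0.
  by rewrite ltr_norml => /andP[+ _]; have := normr_ge0 (z m).1; lra.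
have dge0 : 0 <= d.
  rewrite leNgt; apply/negP => d0.
  have [|m [_ + _]] := near_cd (- d); first by rewrite oppr_gt0.
  by rewrite ltr_norml => /andP[+ _]; have := normr_ge0 (z m).2; lra.
have Ncd : N (c, d) <= 1.
  apply/ler_addgt0Pr => e e0; have [|m [cm dm _]] := near_cd (e / 2); first lra.
  have := abs_norm_lipschitzD N 0 (`|(z m).1|, `|(z m).2|) (c, d).
  rewrite !add0r /=; have := Nz m; lra.
have N2 i : 2 <= N (p i + (c, d)).
  apply/ler_addgt0Pr => e e0; have [|m [cm dm me]] := near_cd (e / 3); first lra.
  have [_ /(_ i) zi] := zP m; have [[a0 b0] _] := pP i.
  have le1 : `|u i + z m| <= N (p i + (`|(z m).1|, `|(z m).2|)).
    rewrite nsum_normE /=; apply: abs_norm_mono_norm => /=.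
      rewrite normr_id (le_trans (ler_normD _ _))// lerD2r normrZ x1 mulr1.
      by rewrite ger0_norm.
    rewrite normr_id (le_trans (ler_normD _ _))// lerD2r normrZ y1 mulr1.
    by rewrite ger0_norm.
  have := abs_norm_lipschitzD N (p i) (c, d) (`|(z m).1|, `|(z m).2|).
  rewrite /= (distrC _ c) (distrC _ d); lra.
have N2' i : N (p i + (c, d)) <= 1 + N (c, d).
  by apply: le_trans (abs_normD _ _ _) _; rewrite (pP i).2.
exists (c, d); split=> //.
  apply/eqP; rewrite eq_le Ncd /=.
  have := N2 (Ordinal n0); have := N2' (Ordinal n0); lra.
move=> i; apply/eqP; rewrite eq_le N2 andbT.
have := N2' i; lra.
Qed.

(** Two vectors whose norms add up remain so when one of them is rescaled: take
    away a part of the longer one.  Hence the pairs need not be normalized. *)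
Lemma pos_octahedral_direction (n : nat) (p : 'I_n -> R * R) :
  positively_octahedral N -> (forall i, pos_pair (p i)) ->
  exists q, [/\ pos_pair q, N q = 1 & forall i, N (p i) + 1 <= N (p i + q)].
Proof.
move=> octN pP.
pose r i := N (p i).
(* For [p i = 0] any positive pair of norm [1] will do. *)
pose p' i : R * R := if r i == 0 then (1, 0)
  else ((r i)^-1 * (p i).1, (r i)^-1 * (p i).2).
have r0 i : 0 <= r i by exact: abs_norm_ge0.
have p'P i : pos_pair (p' i) /\ N (p' i) = 1.
  have [a0 b0] := pP i; rewrite /p'; case: eqVneq => [_|ri0].
    by rewrite abs_norm10; split=> //; split=> /=.
  split; first by split=> /=; rewrite mulr_ge0// invr_ge0.
  rewrite abs_normZ ger0_norm ?invr_ge0//.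
  by rewrite (_ : (_, _) = p i) ?mulVf//; case: (p i).
have pE i : p i = (r i * (p' i).1, r i * (p' i).2).
  rewrite /p'; case: eqVneq => [ri0|ri0] /=.
    by rewrite ri0 !mul0r; exact: abs_norm_eq0 ri0.
  by rewrite !mulVKf//; case: (p i).
have [q [qpos q1 qp]] := octN n p' p'P.
exists q; split=> // i.
move: (qp i) (p'P i).2 (pE i) (r0 i); rewrite -/(r i).
case: (p' i) (p i) => a b [a' b'] /= + + [-> ->].
case: q q1 {qpos qp} => c d q1 /= qp p1 {}r0.
set t := r i in r0 *.
(* With [p = t p'], the longer of [p] and [q] is cut down: for [1 <= t],
   [t (p' + q) = (p + q) + (t - 1) q], and for [t <= 1],
   [p' + q = (p + q) + (1 - t) p']. *)
have [t1|t1] := leP 1 t.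
  have : N (t * (a + c), t * (b + d)) <=
      N (t * a + c, t * b + d) + N ((t - 1) * c, (t - 1) * d).
    rewrite (_ : (t * (a + c), _) =
      (t * a + c, t * b + d) + ((t - 1) * c, (t - 1) * d)); first exact: abs_normD.
    by congr (_, _) => /=; ring.
  rewrite !abs_normZ q1 (_ : (a + c, b + d) = (a, b) + (c, d))// qp.
  rewrite !ger0_norm ?subr_ge0//.
  rewrite (_ : (t * a, t * b) + (c, d) = (t * a + c, t * b + d))//; lra.
have : N (a + c, b + d) <=
    N (t * a + c, t * b + d) + N ((1 - t) * a, (1 - t) * b).
  rewrite (_ : (a + c, _) =
    (t * a + c, t * b + d) + ((1 - t) * a, (1 - t) * b)); first exact: abs_normD.
  by congr (_, _) => /=; ring.
rewrite !abs_normZ p1 (_ : (a + c, b + d) = (a, b) + (c, d))// qp.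
rewrite ger0_norm ?subr_ge0 ?(ltW t1)//.
rewrite (_ : (t * a, t * b) + (c, d) = (t * a + c, t * b + d))//; lra.
Qed.

Lemma octahedral_scaled (Z : normedModType R) (u z : Z) (c e : R) :
  0 <= c <= 1 -> `|z| <= 1 -> `|u| + 1 - e <= `|u + z| ->
  `|u| + c - e <= `|u + c *: z|.
Proof.
move=> /andP[c0 c1] z1 uz.
have : `|u + z| <= `|u + c *: z| + `|(1 - c) *: z|.
  apply: le_trans (ler_normD _ _).
  by rewrite -addrA -scalerDl (addrC c) subrK scale1r.
rewrite normrZ ger0_norm ?subr_ge0// => h.
have : (1 - c) * `|z| <= 1 - c by rewrite -[leRHS]mulr1 ler_wpM2l// subr_ge0.
lra.
Qed.

Lemma octahedral_sum :
  octahedral X -> octahedral Y -> positively_octahedral N ->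
  octahedral (nsum N X Y).
Proof.
move=> octX octY octN s e e0.
pose u (i : 'I_(size s)) : nsum N X Y := s`_i.
have [i|[c d] [[/= c0 d0] Ncd Nu]] := @pos_octahedral_direction (size s)
    (fun i => (`|(u i).1|, `|(u i).2|)) octN.
  by split=> /=.
have c1 : c <= 1 by rewrite -Ncd (le_trans (ler_norm _))// abs_norm_gel.
have d1 : d <= 1 by rewrite -Ncd (le_trans (ler_norm _))// abs_norm_ger.
have e2 : 0 < e / 2 by lra.
have [x x1 xs] := octX [seq (u i).1 | i <- enum 'I_(size s)] _ e2.
have [y y1 ys] := octY [seq (u i).2 | i <- enum 'I_(size s)] _ e2.
exists ((c *: x, d *: y) : nsum N X Y).
  rewrite nsum_normE /= -Ncd !normrZ (ger0_norm c0) (ger0_norm d0).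
  apply: abs_norm_mono_norm; rewrite ger0_norm ?mulr_ge0//.
    by rewrite -[leRHS]mulr1 ler_wpM2l.
  by rewrite -[leRHS]mulr1 ler_wpM2l.
move=> _ /(nthP 0)[k ks <-]; pose i := Ordinal ks; rewrite -[s`_k]/(u i).
have {xs} xi := xs _ (map_f _ (mem_enum _ i)).
have {ys} yi := ys _ (map_f _ (mem_enum _ i)).
have {xi} := @octahedral_scaled _ _ _ c _ _ x1 xi; rewrite c0 c1 => /(_ isT) xi.
have {yi} := @octahedral_scaled _ _ _ d _ _ y1 yi; rewrite d0 d1 => /(_ isT) yi.
have {Nu} := Nu i; rewrite -nsum_normE => Nu.
rewrite [leRHS]nsum_normE /= lerBlDr; apply: le_trans Nu _.
set A := `|_ + c *: x| in xi *; set B := `|_ + d *: y| in yi *.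
apply: (@le_trans _ _ (N (A + e / 2, B + e / 2))).
  by apply: abs_norm_mono_norm => /=; rewrite ger0_norm ?addr_ge0//; lra.
apply: le_trans (abs_normD N (A, B) (e / 2, e / 2)) _; rewrite lerD2l.
apply: le_trans (abs_norm_le_sum _ _ _) _.
by rewrite gtr0_norm// -splitr.
Qed.

End OctahedralSum.

(** * Signs and dense sequences *)

Section Geom.
Context {R : realType}.

Definition geom (j : nat) : R := 2 ^- j.

Lemma geom_gt0 j : 0 < geom j.
Proof. by rewrite invr_gt0 exprn_gt0. Qed.

Lemma geomS j : geom j.+1 = geom j / 2.
Proof. by rewrite /geom exprS invfM mulrC. Qed.

Lemma geom_lt (e : R) :
  0 < e -> exists K, forall j, (K <= j)%N -> geom j < e.
Proof.
move=> /posnumP[{}e]; have [K _ Ke] := near_infty_natSinv_expn_lt e.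
by exists K => j Kj; have := Ke j Kj; rewrite /= div1r.
Qed.

(** The sign of index [k] at time [j] is read off the [k]-th binary digit of
    [j], so that every finite sign pattern occurs arbitrarily late. *)
Definition rademacher (k j : nat) : R := (-1) ^+ odd (j %/ 2 ^ k).

Lemma rademacherK k j : rademacher k j * rademacher k j = 1.
Proof. by rewrite /rademacher -expr2 sqrr_sign. Qed.

Lemma norm_rademacher k j : `|rademacher k j| = 1.
Proof. by rewrite /rademacher normr_sign. Qed.

End Geom.

Lemma binary_digits_prescribed (b : nat -> bool) (K J : nat) :
  exists2 j, (J <= j)%N & forall k, (k < K)%N -> odd (j %/ 2 ^ k) = b k.
Proof.
elim: K b => [|K IH] b; first by exists J.
have [j Jj jb] := IH (fun k => b k.+1).
exists (b 0 + j.*2)%N; first by rewrite -addnn; lia.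
move=> [_|k kK]; first by rewrite expn0 divn1 oddD odd_double addbF oddb.
by rewrite expnS divnMA divn2 half_bit_double -jb.
Qed.

Section DenseSequences.
Context {R : realType}.

Definition dense_seq {X : normedModType R} (g : nat -> X) : Prop :=
  forall x (e : R), 0 < e -> exists k, `|g k - x| < e.

Lemma separable_dense_seq (X : normedModType R) :
  separable X -> exists g : nat -> X, dense_seq g.
Proof.
case=> D /countable_injP[f finj] dD.
have /choice[g gP] n : exists x, (exists2 y, D y & f y = n) -> D x /\ f x = n.
  have [[x Dx fx]|nx] := pselect (exists2 y, D y & f y = n); first by exists x.
  by exists 0.
exists g => x e e0.
have bx : ball x e !=set0 by exists x; exact: ballxx.
have [y []] := dD _ bx (ball_open x e).
rewrite -ball_normE /= => xy Dy; exists (f y).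
have [|Dg fg] := gP (f y); first by exists y.
by rewrite (finj _ _ _ _ fg) ?inE// distrC.
Qed.

Lemma dense_seq_sum (N : abs_norm R) (X Y : normedModType R)
    (g : nat -> X) (h : nat -> Y) :
  dense_seq g -> dense_seq h -> exists d : nat -> nsum N X Y, dense_seq d.
Proof.
move=> gd hd; pose ij k := odflt (0, 0)%N (unpickle k).
exists (fun k => (g (ij k).1, h (ij k).2)) => -[x y] e e0.
have e2 : 0 < e / 2 by rewrite divr_gt0.
have [i gi] := gd x _ e2; have [j hj] := hd y _ e2.
exists (pickle (i, j)); rewrite /ij pickleK /= nsum_normE.
apply: le_lt_trans (abs_norm_le_sum _ _ _) _.
by rewrite !normr_id [e]splitr ltrD.
Qed.

(** Each term is repeated infinitely often, at the times [2 ^ i * (2 * m + 1)]. *)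
Lemma dense_seq_recurrent (X : normedModType R) (g : nat -> X) :
  dense_seq g -> exists d : nat -> X, forall x (e : R) K, 0 < e ->
  exists2 k, (K <= k)%N & `|d k - x| < e.
Proof.
move=> gd; exists (fun k => g (logn 2 k)) => x e K /(gd x)[i gi].
exists (2 ^ i * K.*2.+1)%N.
  by apply: leq_trans (leq_pmull _ _); rewrite ?expn_gt0// -addnn; lia.
rewrite lognM ?expn_gt0// pfactorK// (@lognE 2 K.*2.+1) dvdn2 /= odd_double.
by rewrite addn0.
Qed.

End DenseSequences.

(** * Functionals with prescribed signs *)

Section RademacherSystem.
Context {R : realType} {Z : normedModType R}.
Hypothesis octZ : octahedral Z.
Hypothesis norming : forall (x : Z) (e : R), 0 < e ->
  exists2 f, contractive f & `|x| - e < f x.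
Variable d : nat -> Z.

Let sg := @rademacher R.
Let geom := @geom R.

(** The first inequality serves to build functionals with prescribed signs at [e],
    the second one to make [|y + e|] almost [|y| + 1] for any given vector [y]. *)
Lemma octahedral_step (jS : nat * (nat -> Z)) : exists e : Z, `|e| <= 1 /\
  forall k, (k <= jS.1)%N ->
  `|jS.2 k| + 1 - geom jS.1 <= `|jS.2 k + sg k jS.1 *: e| /\
  `|d k| + 1 - geom jS.1 <= `|d k + e|.
Proof.
case: jS => j S /=.
pose s := [seq sg k j *: S k | k <- iota 0 j.+1] ++ [seq d k | k <- iota 0 j.+1].
have [e e1 es] := octZ s (geom_gt0 j).
exists e; split=> // k kj; have kI : k \in iota 0 j.+1 by rewrite mem_iota.
split; last by apply: es; rewrite mem_cat map_f ?orbT.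
have := es (sg k j *: S k); rewrite mem_cat (map_f (fun k => sg k j *: S k))//.
move=> /(_ isT); rewrite normrZ norm_rademacher mul1r => /le_trans; apply.
rewrite -[leLHS]mul1r -(norm_rademacher k j) -normrZ scalerDr scalerA.
by rewrite rademacherK scale1r.
Qed.

(** The vector [S j k = d k + sum_(k <= i < j) sg k i *: e i] lengthens by almost
    [1] at each step [j >= k].  If [f] is contractive and within [2 * geom j.+1]
    of norming [S j.+1 k], then splitting off [sg k j *: e j] shows that
    [sg k j * f (e j)] is within [2 * geom j.+1 + geom j = 2 * geom j] of [1],
    and that [f] is as close to norming [S j k].  So a functional [f (k, J)]
    that almost norms the last vector [S J k] controls all the earlier ones, with
    errors that depend on the time [j] and not on [J], and tend to [0]; a limit
    along [J] keeps this control for all times. *)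
Lemma rademacher_system : exists (e : nat -> Z) (w : nat -> Z -> R),
  [/\ forall j, `|e j| <= 1,
      forall k j, (k <= j)%N -> `|d k| + 1 - geom j <= `|d k + e j|,
      forall k, contractive (w k),
      forall k, `|d k| - 2 * geom k <= w k (d k) &
      forall k j, (k <= j)%N -> 1 - 2 * geom j <= sg k j * w k (e j)].
Proof.
have [pick pickP] := choice octahedral_step.
pose S := fix S j : nat -> Z := if j is j'.+1
  then fun k => if (k <= j')%N then S j' k + sg k j' *: pick (j', S j') else S j' k
  else d.
pose e j := pick (j, S j).
have e1 j : `|e j| <= 1 by have [] := pickP (j, S j).
have S_start k j : (j <= k)%N -> S j k = d k.
  elim: j => // j IH jk /=; rewrite leqNgt jk /=; exact: IH (ltnW jk).
have S_step k j : (k <= j)%N -> S j.+1 k = S j k + sg k j *: e j.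
  by move=> kj /=; rewrite kj.
have S_norm k j : (k <= j)%N -> `|S j k| + 1 - geom j <= `|S j.+1 k|.
  by move=> kj; rewrite S_step//; have [_ /(_ k kj)[]] := pickP (j, S j).
have /choice[f fP] (kJ : nat * nat) : exists f, contractive f /\
    `|S kJ.2 kJ.1| - 2 * geom kJ.2 <= f (S kJ.2 kJ.1).
  have g0 : 0 < 2 * geom kJ.2 by rewrite mulr_gt0// geom_gt0.
  by have [f cf ff] := norming (S kJ.2 kJ.1) g0; exists f; split; rewrite // ltW.
have down (g : Z -> R) k j : contractive g -> (k <= j)%N ->
    `|S j.+1 k| - 2 * geom j.+1 <= g (S j.+1 k) ->
    `|S j k| - 2 * geom j <= g (S j k) /\ 1 - 2 * geom j <= sg k j * g (e j).
  move=> cg kj; have [lg _] := cg; rewrite {2}S_step//.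
  rewrite (linear_funD _ _ lg) (linear_funZ _ _ lg) /geom geomS => gS.
  have := S_norm k j kj; have gSj := contractive_le (S j k) cg.
  have ge : sg k j * g (e j) <= 1.
    rewrite -(linear_funZ _ _ lg) (le_trans (contractive_le _ cg))//.
    by rewrite normrZ norm_rademacher mul1r.
  rewrite -/geom in gS *; lra.
have f_low k J : forall i j, (i + j)%N = J -> (k <= j)%N ->
    `|S j k| - 2 * geom j <= f (k, J) (S j k).
  elim=> [j <- _|i IH j ijJ kj].
    by rewrite add0n; have [] := fP (k, j).
  have [cf _] := fP (k, J).
  have := IH j.+1; rewrite addnS -addSn => /(_ ijJ (leqW kj)).
  by case/(down _ _ _ cf kj).
have f_e k j J : (k <= j)%N -> (j < J)%N ->
    1 - 2 * geom j <= sg k j * f (k, J) (e j).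
  move=> kj jJ; have [cf _] := fP (k, J).
  have := @f_low k J (J - j.+1)%N j.+1; rewrite subnK// => /(_ erefl (leqW kj)).
  by case/(down _ _ _ cf kj).
have [U [UF ooU Ulim]] := ultralimits R.
have /choice[l lP] (kz : nat * Z) :
    exists l : R, (fun J => f (kz.1, J) kz.2) @ U --> l.
  by apply: Ulim => J; have [[_ fx] _] := fP (kz.1, J); exact: fx.
have l_ge kz a K : (forall J, (K <= J)%N -> a <= f (kz.1, J) kz.2) -> a <= l kz.
  move=> af; apply: (cvgr_to_ge (lP kz)).
  by apply: ooU; exists K => // J /= KJ; exact: af.
have l_le kz a K : (forall J, (K <= J)%N -> f (kz.1, J) kz.2 <= a) -> l kz <= a.
  move=> af; apply: (cvgr_to_le (lP kz)).
  by apply: ooU; exists K => // J /= KJ; exact: af.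
exists e, (fun k z => l (k, z)); split=> //.
- by move=> k j kj; have [_ /(_ k kj)[]] := pickP (j, S j).
- move=> k; split=> [a x y|x].
    apply: (norm_cvg_unique (lP (k, a *: x + y))).
    rewrite (_ : (fun J => _) = (fun J => a * f (k, J) x + f (k, J) y)).
      apply: cvgD; last exact: lP (k, y).
      by apply: cvgMl_tmp; exact: lP (k, x).
    by apply/funext => J /=; have [[lf _] _] := fP (k, J); rewrite lf.
  have fx J : `|f (k, J) x| <= `|x| by have [[]] := fP (k, J).
  rewrite ler_norml; apply/andP; split.
    by apply: (l_ge _ _ 0) => J _; have := fx J; rewrite ler_norml => /andP[].
  by apply: (l_le _ _ 0) => J _; have := fx J; rewrite ler_norml => /andP[].
- move=> k; apply: (l_ge _ _ k) => J kJ /=.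
  have := @f_low k J (J - k)%N k; rewrite subnK// => /(_ erefl (leqnn _)).
  by rewrite S_start.
move=> k j kj; rewrite /sg /rademacher; have := f_e k j; rewrite /sg /rademacher.
case: (odd _) => fe; last first.
  rewrite expr0 mul1r; apply: (l_ge _ _ j.+1) => J jJ /=.
  by have := fe J kj jJ; rewrite expr0 mul1r.
rewrite expr1 mulN1r lerNr; apply: (l_le _ _ j.+1) => J jJ /=.
by have := fe J kj jJ; rewrite expr1 mulN1r lerNr.
Qed.

End RademacherSystem.

(** * Functionals on absolute sums *)

Section SumFunctionals.
Context {R : realType} (N : abs_norm R).

(** The one-dimensional step of the Hahn-Banach theorem: the functional is given
    on the line through [(A, B)], and [beta] is its value at [(0, 1)]. *)
Lemma abs_norm_supporting_line (A B : R) : 0 < A ->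
  exists alpha beta : R, alpha * A + beta * B = N (A, B) /\
  forall a b, alpha * a + beta * b <= N (a, b).
Proof.
move=> A0; set n := N (A, B).
have gap s t : s * n - N (s * A, s * B - 1) <= N (t * A, t * B + 1) - t * n.
  have : `|s + t| * n <= N (s * A, s * B - 1) + N (t * A, t * B + 1).
    rewrite -abs_normZ (_ : ((s + t) * A, _) =
      (s * A, s * B - 1) + (t * A, t * B + 1)); first exact: abs_normD.
    by congr (_, _) => /=; ring.
  have : (s + t) * n <= `|s + t| * n by rewrite ler_wpM2r ?abs_norm_ge0 ?ler_norm.
  lra.
pose E := [set s * n - N (s * A, s * B - 1) | s in [set: R]].
have supE : has_sup E.
  split; first by exists (0 * n - N (0 * A, 0 * B - 1)); exists 0.
  by exists (N (0 * A, 0 * B + 1) - 0 * n) => _ [s _ <-]; exact: gap.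
pose beta := sup E.
have low s : s * n - beta <= N (s * A, s * B - 1).
  have : s * n - N (s * A, s * B - 1) <= beta.
    by apply: sup_upper_bound => //; exists s.
  lra.
have high t : t * n + beta <= N (t * A, t * B + 1).
  have : beta <= N (t * A, t * B + 1) - t * n.
    by apply: ge_sup; [case: supE|move=> _ [s _ <-]; exact: gap].
  lra.
have line s t : s * n + t * beta <= N (s * A, s * B + t).
  have [t0|t0|->] := ltgtP t 0.
  - have t0' : t != 0 by rewrite lt_eqF.
    have := low (s / - t); rewrite -(ler_pM2l (x := - t)) ?oppr_gt0// => h.
    have -> : (s * A, s * B + t) =
        (- t * (s / - t * A), - t * (s / - t * B - 1)).
      by congr (_, _); field.
    rewrite abs_normZ [`|_|]gtr0_norm ?oppr_gt0//.
    rewrite (_ : s * n + _ = - t * (s / - t * n - beta)); first exact: h.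
    by field.
  - have t0' : t != 0 by rewrite gt_eqF.
    have := high (s / t); rewrite -(ler_pM2l (x := t))// => h.
    have -> : (s * A, s * B + t) = (t * (s / t * A), t * (s / t * B + 1)).
      by congr (_, _); field.
    rewrite abs_normZ [`|_|]gtr0_norm//.
    rewrite (_ : s * n + _ = t * (s / t * n + beta)); first exact: h.
    by field.
  by rewrite mul0r !addr0 abs_normZ ler_wpM2r ?abs_norm_ge0 ?ler_norm.
have A0' : A != 0 by rewrite gt_eqF.
exists ((n - beta * B) / A), beta; split; first by field.
move=> a b; have := line (a / A) (b - a / A * B).
rewrite (_ : a / A * A = a); last by field.
rewrite (_ : a / A * B + _ = b); last by field.
by rewrite (_ : a / A * n + _ = (n - beta * B) / A * a + beta * b)//; field.
Qed.

(** By absoluteness the coefficients of a supporting line can be replaced by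
    their absolute values. *)
Lemma abs_norm_positive_support (A B : R) : 0 <= A -> 0 <= B ->
  exists alpha beta : R, [/\ 0 <= alpha, 0 <= beta,
    alpha * A + beta * B = N (A, B) &
    forall a b, 0 <= a -> 0 <= b -> alpha * a + beta * b <= N (a, b)].
Proof.
move=> A0 B0; have [A1|An0] := eqVneq A 0.
  exists 0, 1; rewrite A1 abs_norm0r ger0_norm//; split=> //; first by ring.
  move=> a b a0 b0; rewrite mul0r mul1r add0r.
  exact: le_trans (ler_norm b) (abs_norm_ger _ _ _).
have Agt0 : 0 < A by rewrite lt_def An0.
have [alpha [beta [eqAB leN]]] := abs_norm_supporting_line B Agt0.
have leN' a b : 0 <= a -> 0 <= b -> `|alpha| * a + `|beta| * b <= N (a, b).
  move=> a0 b0; rewrite -(ger0_norm a0) -(ger0_norm b0) -!normrM.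
  have signed (x y : R) : exists2 y', x * y' = `|x * y| & `|y'| = `|y|.
    have [xy|xy] := leP 0 (x * y); first by exists y; rewrite // ger0_norm.
    by exists (- y); rewrite ?normrN// mulrN ltr0_norm.
  have [a' aE na'] := signed alpha a; have [b' bE nb'] := signed beta b.
  by rewrite -aE -bE -na' -nb' -abs_norm_abs; exact: leN.
exists `|alpha|, `|beta|; split=> //.
apply/eqP; rewrite eq_le leN'//= -eqAB.
by apply: lerD; rewrite ler_wpM2r// ler_norm.
Qed.

Lemma norming_sum (X Y : normedModType R) :
  (forall (x : X) e, 0 < e -> exists2 f, contractive f & `|x| - e < f x) ->
  (forall (y : Y) e, 0 < e -> exists2 f, contractive f & `|y| - e < f y) ->
  forall (z : nsum N X Y) e, 0 < e -> exists2 f, contractive f & `|z| - e < f z.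
Proof.
move=> nX nY [x y] e e0.
have [alpha [beta [al0 be0 eqN leN]]] :=
  abs_norm_positive_support (normr_ge0 x) (normr_ge0 y).
pose e' := e / (alpha + beta + 1).
have ab0 : 0 < alpha + beta + 1 by lra.
have e'0 : 0 < e' by rewrite divr_gt0.
have [f cf fx] := nX x _ e'0; have [g cg gy] := nY y _ e'0.
have [[lf fle] [lg gle]] := (cf, cg).
exists (fun z : nsum N X Y => alpha * f z.1 + beta * g z.2).
  split=> [a [x1 y1] [x2 y2]|[x1 y1]].
    rewrite /= (linear_funD _ _ lf) (linear_funD _ _ lg).
    rewrite (linear_funZ _ _ lf) (linear_funZ _ _ lg) /GRing.scale /=; ring.
  rewrite [leRHS]nsum_normE /=; apply: le_trans (leN _ _ _ _) => //.
  apply: le_trans (ler_normD _ _) _; rewrite !normrM (ger0_norm al0) (ger0_norm be0).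
  by apply: lerD; rewrite ler_wpM2l.
rewrite nsum_normE /= -eqN.
have : alpha * (`|x| - e') <= alpha * f x by rewrite ler_wpM2l// ltW.
have : beta * (`|y| - e') <= beta * g y by rewrite ler_wpM2l// ltW.
have : (alpha + beta + 1) * e' = e by rewrite mulrC divfK ?gt_eqF.
lra.
Qed.

End SumFunctionals.

(** * Octahedral separable spaces have the almost Daugavet property *)

Section OctahedralDaugavet.
Context {R : realType} {Z : completeNormedModType R}.

Section RademacherSpan.
Variables (e : nat -> Z) (d : nat -> Z) (w : nat -> Z -> R).
Hypotheses (e_ball : forall j, `|e j| <= 1) (w_ball : forall k, contractive (w k)).
Hypothesis d_dense : forall x (eps : R) K, 0 < eps ->
  exists2 k, (K <= k)%N & `|d k - x| < eps.
Hypothesis e_far : forall k j, (k <= j)%N -> `|d k| + 1 - geom j <= `|d k + e j|.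
Hypothesis w_sign : forall k j, (k <= j)%N ->
  1 - 2 * geom j <= rademacher k j * w k (e j).

Definition combination (c : nat -> R) (K : nat) (z : Z) : R :=
  \sum_(k < K) c k * w k z.

Lemma combination_le c K z :
  `|combination c K z| <= (\sum_(k < K) `|c k|) * `|z|.
Proof.
apply: le_trans (ler_norm_sum _ _ _) _; rewrite mulr_suml ler_sum// => k _.
by rewrite normrM ler_wpM2l//; case: (w_ball k).
Qed.

Lemma combination_widen c K K' : (K <= K')%N ->
  (forall k, (K <= k)%N -> c k = 0) -> combination c K' = combination c K.
Proof.
move=> KK' c0; apply/funext => z; rewrite /combination.
rewrite (big_ord_widen K' (fun k => c k * w k z) KK') [RHS]big_mkcond.
by apply: eq_bigr => k _; case: ltnP => // Kk; rewrite c0// mul0r.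
Qed.

(** The signs of the [w k (e j)], [k < K], run through all patterns; pick a late
    [j] for which they are those of the coefficients. *)
Lemma combination_attained (c : nat -> R) (K J : nat) (delta : R) : 0 < delta ->
  exists j, [/\ (J <= j)%N, geom j < delta &
  (\sum_(k < K) `|c k|) * (1 - 2 * geom j) <= combination c K (e j)].
Proof.
move=> /geom_lt[L Ldelta].
have [j Mj jb] :=
  binary_digits_prescribed (fun k => c k < 0) K (maxn J (maxn L K)).
move: Mj; rewrite !geq_max => /and3P[Jj Lj Kj].
exists j; split; rewrite ?Ldelta// mulr_suml ler_sum// => k _.
have := w_sign (leq_trans (ltnW (ltn_ord k)) Kj).
rewrite /rademacher jb// => h.
by rewrite [X in _ <= X * _](realEsign (num_real _)) -mulrA mulrCA ler_wpM2l.
Qed.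

(** With [C] the sum of the [|c k|], a term [d i] close to [C *: x], and [j] given
    by [combination_attained], the image of [e j] is close to [e j + C *: x], hence
    to [e j + d i], whose norm is almost [1 + C * |x|]. *)
Lemma combination_daugavet c K (x : Z) :
  opnorm (fun z => z + rank_one (combination c K) x z) =
  1 + opnorm (rank_one (combination c K) x).
Proof.
set f := combination c K; set T := rank_one f x.
pose C := \sum_(k < K) `|c k|.
have C0 : 0 <= C by apply: sumr_ge0.
have T_le z : `|z| <= 1 -> `|T z| <= C * `|x|.
  move=> z1; rewrite normrZ ler_wpM2r// (le_trans (combination_le _ _ _))//.
  by rewrite -[leRHS]mulr1 ler_wpM2l.
have IT_le z : `|z| <= 1 -> `|z + T z| <= 1 + opnorm T.
  move=> z1; apply: le_trans (ler_normD _ _) _; apply: lerD => //.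
  exact: le_opnorm T_le z1.
apply/eqP; rewrite eq_le; apply/andP; split; first exact: opnorm_le.
apply: (@le_trans _ _ (1 + C * `|x|)); first by rewrite lerD2l; exact: opnorm_le.
have Cx0 : 0 <= C * `|x| by rewrite mulr_ge0.
apply/ler_addgt0Pr => eps eps0.
have eps4 : 0 < eps / 4 by lra.
have [i _ di] := d_dense (C *: x) 0 eps4.
have delta0 : 0 < eps / 4 / (1 + 2 * (C * `|x|)) by rewrite divr_gt0//; lra.
have [j [ij gj fj]] := combination_attained c K i delta0.
have {}gj : geom j * (1 + 2 * (C * `|x|)) < eps / 4 by rewrite -ltr_pdivlMr//; lra.
apply: le_trans (lerD (le_opnorm IT_le (e_ball j)) (lexx eps)).
have fj_le : f (e j) <= C.
  apply: le_trans (ler_norm _) (le_trans (combination_le _ _ _) _).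
  by rewrite -[leRHS]mulr1 ler_wpM2l.
have h1 : `|d i + e j| <= `|e j + T (e j)| + `|d i - C *: x| + `|(C - f (e j)) *: x|.
  rewrite (_ : d i + e j = (e j + T (e j)) + (d i - C *: x) + (C - f (e j)) *: x).
    by apply: le_trans (ler_normD _ _) _; rewrite lerD2r; exact: ler_normD.
  by rewrite /T /rank_one scalerBl -addrA subrKA addrACA subrr addr0 addrC.
have h2 : `|(C - f (e j)) *: x| <= geom j * (2 * (C * `|x|)).
  rewrite normrZ ger0_norm ?subr_ge0// (_ : _ * (2 * _) = (C * (2 * geom j)) * `|x|).
    by rewrite ler_wpM2r//; move: fj; rewrite -/f -/C; lra.
  by ring.
have h3 : C * `|x| <= `|d i| + `|d i - C *: x|.
  rewrite -[C in leLHS](ger0_norm C0) -normrZ -[C *: x in leLHS](subKr (d i)).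
  exact: ler_normB.
have := e_far ij; lra.
Qed.

Definition span_functionals : set (Z -> R) :=
  [set f | exists (c : nat -> R) (K : nat),
     (forall k, (K <= k)%N -> c k = 0) /\ f = combination c K].

Lemma span_dual_subspace : dual_subspace span_functionals.
Proof.
split.
- move=> _ [c [K [_ ->]]].
  apply: (@linear_bounded_dual _ _ _ (\sum_(k < K) `|c k|)).
    move=> a x y; rewrite /combination /GRing.scale /= mulr_sumr -big_split /=.
    apply: eq_bigr => k _; have [lw _] := w_ball k.
    by rewrite (linear_funD _ _ lw) (linear_funZ _ _ lw); ring.
  by move=> z; exact: combination_le.
- exists (fun=> 0), 0%N; split=> //.
  by apply/funext => z; rewrite /combination big_ord0.
move=> a _ _ [c [K [c0 ->]]] [c' [K' [c0' ->]]].
exists (fun k => a * c k + c' k), (maxn K K'); split=> [k|].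
  by rewrite geq_max => /andP[? ?]; rewrite c0// c0'// mulr0 addr0.
apply/funext => z.
rewrite -(combination_widen (leq_maxl K K') c0).
rewrite -(combination_widen (leq_maxr K K') c0').
rewrite /combination mulr_sumr -big_split /=.
by apply: eq_bigr => k _; ring.
Qed.

(** The error [2 * geom k] allowed at [d k] is harmless because [d] comes close to
    every vector at arbitrarily late times. *)
Lemma span_one_norming :
  (forall k, `|d k| - 2 * geom k <= w k (d k)) -> one_norming span_functionals.
Proof.
move=> w_d x; set A := (X in sup X).
have Ax : ubound A `|x|.
  move=> _ [f [Wf f1] <-]; have [Wd _ _] := span_dual_subspace.
  by have [_] := opnorm_le1_contractive (Wd _ Wf) f1.
have wA k : A `|w k x|.
  exists (w k) => //; split; last exact: contractive_opnorm.
  exists (fun l => (l == k)%:R), k.+1; split.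
    by move=> l kl; rewrite gtn_eqF.
  apply/funext => z; rewrite /combination big_ord_recr /= eqxx mul1r.
  by rewrite big1 ?add0r// => l _; rewrite ltn_eqF ?mul0r.
apply/eqP; rewrite eq_le; apply/andP; split; last first.
  by apply: ge_sup => //; exists `|w 0%N x|; exact: wA.
apply/ler_addgt0Pr => eps eps0.
have eps4 : 0 < eps / 4 by lra.
have [K Kgeom] := geom_lt eps4.
have [k Kk dk] := d_dense x K eps4.
have {}Kgeom := Kgeom k Kk.
have wkA : `|w k x| <= sup A by apply: ub_le_sup => //; exists `|x|.
have [lw _] := w_ball k.
have h1 : w k (d k) <= w k x + `|d k - x|.
  rewrite -[d k in leLHS](subrK x) (linear_funD _ _ lw) addrC lerD2l.
  exact: contractive_le.
have h2 : `|x| <= `|d k| + `|d k - x|.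
  by rewrite -[x in leLHS](subKr (d k)) ler_normB.
have := w_d k; have := ler_norm (w k x); lra.
Qed.

End RademacherSpan.

Lemma octahedral_almost_daugavet (g : nat -> Z) :
  dense_seq g ->
  (forall (x : Z) (eps : R), 0 < eps ->
     exists2 f, contractive f & `|x| - eps < f x) ->
  octahedral Z -> almost_daugavet Z.
Proof.
move=> /dense_seq_recurrent[d d_dense] norming octZ.
have [e [w [e_ball e_far w_ball w_d w_sign]]] := rademacher_system octZ norming d.
exists (span_functionals w); split.
- exact: span_dual_subspace.
- exact: (span_one_norming w_ball d_dense w_d).
by move=> x _ [c [K [_ ->]]]; exact: (combination_daugavet e_ball w_ball d_dense).
Qed.

End OctahedralDaugavet.

Theorem corollary3p3 (R : realType) (X Y : completeNormedModType R)
    (N : abs_norm R)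
    (Xnontriv : nontrivial X) (Ynontriv : nontrivial Y)
    (Xsep : separable X) (Ysep : separable Y)
    (XAD : almost_daugavet X) (YAD : almost_daugavet Y) :
  almost_daugavet (nsum N X Y) <-> positively_octahedral N.
Proof.
split=> [ZAD|octN].
  have Znontriv : nontrivial (nsum N X Y : completeNormedModType R).
    have [x x0] := Xnontriv; exists (x, 0).
    by apply: contra x0 => /eqP[->].
  exact: octahedral_sum_pos (almost_daugavet_octahedral Znontriv ZAD).
have norming (V : completeNormedModType R) : almost_daugavet V ->
    forall (x : V) e, 0 < e -> exists2 f, contractive f & `|x| - e < f x.
  move=> [W [sW nW _]] x e e0.
  by have [f [_ cf fx]] := one_norming_approx x sW nW e0; exists f.
have [g gd] := separable_dense_seq Xsep.
have [h hd] := separable_dense_seq Ysep.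
have [d dd] := dense_seq_sum N gd hd.
apply: (octahedral_almost_daugavet dd).
  exact: norming_sum (norming _ XAD) (norming _ YAD).
by apply: octahedral_sum => //; exact: almost_daugavet_octahedral.
Qed.
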